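(* Assume $r'\ge r$, $\mu=0$, and $W\neq\emptyset$. Then the set of Patil generators $$\Omega=\{\xi_{i,j}\mid 1\le i\le j\le p-1\}\cup\{\theta\}\cup\{\varphi_i\mid i\in I\}\cup\{\psi_j\mid j\in J\}$$ of the ideal $P$ is not a Groebner basis of $P$ with respect to the grevlex monomial order with $x_0<x_1<\cdots<x_n$ and with the grading $wt(x_i)=m_i$.
   Context: Setting. Let $K$ be a field, $n\ge 2$ an integer, $p=n-1$. Let $m_0,\dots,m_p$ be an arithmetic sequence of positive integers with $0<m_0<\cdots<m_p$, let $m_n$ be an arbitrary positive integer, and assume $\gcd(m_0,\dots,m_n)=1$. Let $\mathbb N_0=\{0,1,2,\dots\}$, $\Gamma=\sum_{i=0}^n\mathbb N_0m_i$, $\Gamma'=\sum_{i=0}^p\mathbb N_0m_i$. Assume $\Gamma$ is minimally generated by $m_0,\dots,m_n$. Let $P$ be the kernel of the $K$-algebra homomorphism $\eta:K[x_0,\dots,x_n]\to K[t]$, $\eta(x_i)=t^{m_i}$. For integers $a,b$ let $[a,b]=\{t\in\mathbb Z\mid a\le t\le b\}$ (empty if $a>b$). For an integer $t\ge0$ define $q_t\in\mathbb Z$, $r_t\in[1,p]$ and $g_t$ by $t=q_tp+r_t$ and $g_t=q_tm_p+m_{r_t}$ (so $q_0=-1$, $r_0=p$, $g_0=0$). Parameters. Let $S=\{\gamma\in\Gamma\mid\gamma-m_0\notin\Gamma\}$, $u=\min\{t\ge0\mid g_t\notin S\}$, $\upsilon=\min\{b\ge1\mid bm_n\in\Gamma'\}$.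 By a known lemma of Patil and Singh there exist unique integers $w\in[0,\upsilon-1]$, $z\in[0,u-1]$, $\lambda\ge1$, $\mu\ge0$, $\nu\ge2$ such that (i) $g_u=\lambda m_0+wm_n$; (ii) $\upsilon m_n=\mu m_0+g_z$; (iii) $g_{u-z}+(\upsilon-w)m_n=\nu m_0$, where $\nu=\lambda+\mu+1$ if $r_{u-z}<r_u$ and $\nu=\lambda+\mu$ if $r_{u-z}\ge r_u$. Put $q=q_u$, $r=r_u$, $q'=q_{u-z}$, $r'=r_{u-z}$, $V=[0,u-1]\times[0,\upsilon-1]$, $W=[u-z,u-1]\times[\upsilon-w,\upsilon-1]$. Index sets. $I=[0,p-r]$ if $\mu\ne0$ or $W=\emptyset$, and $I=[\max(r_z-r+1,0),p-r]$ if $\mu=0$ and $W\ne\emptyset$. $J=\emptyset$ if $W=\emptyset$, and $J=[0,\min(z-1,p-r')]$ if $W\neq\emptyset$. Binomials. $\varphi_i=x_{r+i}x_p^{q}-x_0^{\lambda-1}x_ix_n^{w}$; $\psi_j=x_{r'+j}x_p^{q'}x_n^{\upsilon-w}-x_0^{\nu-1}x_j$; $\theta=x_n^{\upsilon}-x_0^{\mu}x_{r-r'}x_p^{q-q'}$ if $r'<r$, and $\theta=x_n^{\upsilon}-x_0^{\mu}x_{p+r-r'}x_p^{q-q'-1}$ if $r'\ge r$ (with $x_px_p^{-1}$ read as $1$); $\xi_{i,j}=x_ix_j-x_0x_{i+j}$ if $i+j\le p$, and $\xi_{i,j}=x_ix_j-x_{i+j-p}x_p$ if $i+j>p$. (It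 is known, due to Patil, that $\Omega$ is a minimal generating set of $P$.) Monomial order. Monomials are compared first by weighted degree $\sum a_im_i$; for equal weighted degree, $\prod_{i=0}^n x_i^{a_i}>\prod_{i=0}^n x_i^{b_i}$ if the left-most nonzero entry of $(a_0-b_0,\dots,a_n-b_n)$ is negative. *)

(* Defs.v *)
From mathcomp Require Export all_boot all_order all_algebra.
From mathcomp Require Export mpoly.

Set Implicit Arguments.
Unset Strict Implicit.
Unset Printing Implicit Defensive.

Import Order.TTheory GRing.Theory Num.Theory.
Local Open Scope ring_scope.

(* The weights m_0, ..., m_n are the first n+1 values of m : nat -> nat; the
   others are never used.  Throughout p = n - 1 is written n.-1, and the
   semigroups live in int so that subtraction is not truncated. *)

Definition zitv (a b : int) : seq int :=
  if a <= b then [seq a + k%:Z | k <- iota 0 `|b - a|%N.+1] else [::].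

Lemma mem_zitv (a b t : int) : (t \in zitv a b) = (a <= t <= b).
Proof.
rewrite /zitv; case: (lerP a b) => [le_ab|lt_ba]; last first.
  rewrite in_nil; apply/esym/negP => /andP[le_at le_tb].
  by move: (le_trans le_at le_tb); rewrite leNgt lt_ba.
apply/mapP/andP => [[k + ->]|[le_at le_tb]].
  rewrite mem_iota add0n ltnS => /andP[_ le_k]; split; first by rewrite lerDl.
  by rewrite -lerBrDl -[b - a]gez0_abs ?subr_ge0.
exists `|t - a|%N; last by rewrite gez0_abs ?subr_ge0 // subrKC.
rewrite mem_iota add0n ltnS /= -lez_nat !gez0_abs ?subr_ge0 //.
exact: lerB.
Qed.

Definition is_min (A : nat -> Prop) (b : nat) : Prop :=
  A b /\ forall t, A t -> (b <= t)%N.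

Definition generated_by (n : nat) (m : nat -> nat) (A : {set 'I_n.+1})
    (gamma : int) : Prop :=
  exists a : 'I_n.+1 -> nat, gamma = (\sum_(i in A) a i * m i)%N%:Z.

Definition Gamma (n : nat) (m : nat -> nat) : int -> Prop :=
  @generated_by n m [set: 'I_n.+1].

Definition Gamma' (n : nat) (m : nat -> nat) : int -> Prop :=
  @generated_by n m [set i : 'I_n.+1 | (i <= n.-1)%N].

Definition minimally_generated (n : nat) (m : nat -> nat) : Prop :=
  forall A : {set 'I_n.+1},
    (forall gamma, generated_by m A gamma <-> Gamma n m gamma) ->
    A = [set: 'I_n.+1].

Definition arithmetic_upto (p : nat) (m : nat -> nat) : Prop :=
  exists d : nat, forall i, (i < p)%N -> m i.+1 = (m i + d)%N.

(* t = qt n t * p + rt n t with rt n t in [1, p], see qt_rtP. *)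
Definition qt (n t : nat) : int := ((t%:Z - 1) %/ n.-1%:Z)%Z.
Definition rt (n t : nat) : nat := `|(t%:Z - qt n t * n.-1%:Z)%R|%N.

Lemma qt_rtP (n t : nat) : (2 <= n)%N ->
  t%:Z = qt n t * n.-1%:Z + (rt n t)%:Z /\ (1 <= rt n t <= n.-1)%N.
Proof.
case: n => [|[|n]] //= _.
have Et : t%:Z - qt n.+2 t * n.+1%:Z = ((t%:Z - 1) %% n.+1)%Z + 1.
  by rewrite /modz /qt /= addrAC subrK.
have ge0 : 0 <= ((t%:Z - 1) %% n.+1)%Z by apply: modz_ge0.
have lt : ((t%:Z - 1) %% n.+1)%Z < n.+1%:Z by apply: ltz_pmod.
have Er : (rt n.+2 t)%:Z = ((t%:Z - 1) %% n.+1)%Z + 1.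
  by rewrite /rt /= Et gez0_abs // addr_ge0.
split; first by rewrite Er -Et subrKC.
by rewrite -!lez_nat Er lerDr ge0 /= lezD1.
Qed.

Definition gseq (n : nat) (m : nat -> nat) (t : nat) : int :=
  qt n t * (m n.-1)%:Z + (m (rt n t))%:Z.

Definition Sset (n : nat) (m : nat -> nat) (gamma : int) : Prop :=
  Gamma n m gamma /\ ~ Gamma n m (gamma - (m 0%N)%:Z).

Definition is_u (n : nat) (m : nat -> nat) (u : nat) : Prop :=
  is_min (fun t => ~ Sset n m (gseq n m t)) u.

Definition is_upsilon (n : nat) (m : nat -> nat) (ups : nat) : Prop :=
  is_min (fun b => (1 <= b)%N /\ Gamma' n m (b * m n)%N%:Z) ups.

(* These integers exist and are unique (Patil and Singh). *)
Definition patil_singh (n : nat) (m : nat -> nat)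
    (u ups w z lam mu nu : nat) : Prop :=
  [/\ [/\ (w < ups)%N, (z < u)%N, (1 <= lam)%N & (2 <= nu)%N],
      gseq n m u = (lam * m 0 + w * m n)%N%:Z,
      (ups * m n)%N%:Z = (mu * m 0)%N%:Z + gseq n m z,
      gseq n m (u - z) + ((ups - w) * m n)%N%:Z = (nu * m 0)%N%:Z
    & nu = if (rt n (u - z) < rt n u)%N then (lam + mu + 1)%N
           else (lam + mu)%N].

Definition Wset (u ups w z : nat) : seq (int * int) :=
  [seq (a, b) | a <- zitv (u%:Z - z%:Z) (u%:Z - 1),
                b <- zitv (ups%:Z - w%:Z) (ups%:Z - 1)].

Definition Iset (n u ups w z mu : nat) : seq int :=
  if (mu != 0%N) || (Wset u ups w z == [::])
  then zitv 0 (n.-1%:Z - (rt n u)%:Z)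
  else zitv (Num.max ((rt n z)%:Z - (rt n u)%:Z + 1) 0)
            (n.-1%:Z - (rt n u)%:Z).

Definition Jset (n u ups w z : nat) : seq int :=
  if Wset u ups w z == [::] then [::]
  else zitv 0 (Num.min (z%:Z - 1) (n.-1%:Z - (rt n (u - z))%:Z)).

(* The variable x_k, for 0 <= k <= n.  Below, none of the nat subtractions
   u - z, ups - w, lam - 1, nu - 1 truncates, by patil_singh. *)
Definition xvar (K : fieldType) (n : nat) (k : int) : {mpoly K[n.+1]} :=
  'X_(inord `|k|%N).

(* x_k * x_p ^ e for e >= -1; e = -1 only occurs with k = p. *)
Definition xpow (K : fieldType) (n : nat) (k e : int) : {mpoly K[n.+1]} :=
  if e == -1 then 1 else xvar K n k * xvar K n n.-1%:Z ^+ `|e|%N.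

Definition phi (K : fieldType) (n u w lam : nat) (i : int) : {mpoly K[n.+1]} :=
  xpow K n ((rt n u)%:Z + i) (qt n u)
  - xvar K n 0 ^+ (lam - 1) * xvar K n i * xvar K n n%:Z ^+ w.

Definition psi (K : fieldType) (n u ups w z nu : nat) (j : int) :
    {mpoly K[n.+1]} :=
  xpow K n ((rt n (u - z))%:Z + j) (qt n (u - z)) * xvar K n n%:Z ^+ (ups - w)
  - xvar K n 0 ^+ (nu - 1) * xvar K n j.

Definition theta (K : fieldType) (n u ups z mu : nat) : {mpoly K[n.+1]} :=
  let r := (rt n u)%:Z in let r' := (rt n (u - z))%:Z in
  let q := qt n u in let q' := qt n (u - z) in
  xvar K n n%:Z ^+ ups
  - xvar K n 0 ^+ mu * (if r' < r then xpow K n (r - r') (q - q')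
                        else xpow K n (n.-1%:Z + r - r') (q - q' - 1)).

Definition xi (K : fieldType) (n : nat) (i j : int) : {mpoly K[n.+1]} :=
  xvar K n i * xvar K n j
  - (if i + j <= n.-1%:Z then xvar K n 0 * xvar K n (i + j)
     else xvar K n (i + j - n.-1%:Z) * xvar K n n.-1%:Z).

Definition Omega (K : fieldType) (n u ups w z lam mu nu : nat) :
    seq {mpoly K[n.+1]} :=
  [seq xi K n i j | i <- zitv 1 (n.-1%:Z - 1), j <- zitv i (n.-1%:Z - 1)]
  ++ [:: theta K n u ups z mu]
  ++ [seq phi K n u w lam i | i <- Iset n u ups w z mu]
  ++ [seq psi K n u ups w z nu j | j <- Jset n u ups w z].

Definition eta (K : fieldType) (n : nat) (m : nat -> nat)
    (f : {mpoly K[n.+1]}) : {poly K} :=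
  mmap (@polyC K) (fun i : 'I_n.+1 => 'X ^+ m i) f.

Definition idealP (K : fieldType) (n : nat) (m : nat -> nat)
    (f : {mpoly K[n.+1]}) : Prop := eta m f = 0.

Definition wt (n : nat) (m : nat -> nat) (a : 'X_{1..n.+1}) : nat :=
  (\sum_(i < n.+1) a i * m i)%N.

(* b < a: compare weights first; for equal weights, the left-most nonzero entry
   of a - b is negative. *)
Definition grevlex_lt (n : nat) (m : nat -> nat) (b a : 'X_{1..n.+1}) : bool :=
  (wt m b < wt m a)%N
  || (wt m b == wt m a)
     && [exists i : 'I_n.+1, (a i < b i)%N
           && [forall j : 'I_n.+1, (j < i)%N ==> (a j == b j)]].

Definition is_lead (K : fieldType) (n : nat) (m : nat -> nat)
    (f : {mpoly K[n.+1]}) (a : 'X_{1..n.+1}) : Prop :=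
  a \in msupp f /\
  forall b, b \in msupp f -> b != a -> grevlex_lt m b a.

Definition ideal_gen (K : fieldType) (n : nat) (A : {mpoly K[n.+1]} -> Prop)
    (f : {mpoly K[n.+1]}) : Prop :=
  exists s : seq ({mpoly K[n.+1]} * {mpoly K[n.+1]}),
    (forall c, c \in s -> A c.2) /\ f = \sum_(c <- s) c.1 * c.2.

Definition initial_ideal (K : fieldType) (n : nat) (m : nat -> nat)
    (A : {mpoly K[n.+1]} -> Prop) : {mpoly K[n.+1]} -> Prop :=
  ideal_gen (fun h => exists f a, [/\ A f, is_lead m f a & h = 'X_[a]]).

Definition groebner_basis (K : fieldType) (n : nat) (m : nat -> nat)
    (G : seq {mpoly K[n.+1]}) (I : {mpoly K[n.+1]} -> Prop) : Prop :=
  (forall g, g \in G -> I g) /\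
  (forall f, initial_ideal m (fun g => g \in G) f <-> initial_ideal m I f).

(* Main.v *)
Require Import Defs.
From mathcomp Require Import zify.

Set Implicit Arguments.
Unset Strict Implicit.
Unset Printing Implicit Defensive.

Import Order.TTheory GRing.Theory Num.Theory.
Local Open Scope ring_scope.

(** Write p = n - 1.  The index set I omits 0, although
    phi_0 = x_r x_p^q - x_0^lambda x_n^w belongs to P by the relation
    g_u = lambda m_0 + w m_n.  Its leading monomial is a = x_r x_p^q, because
    the other term involves x_0.  If Omega were a Groebner basis, the leading
    monomial of some Patil generator would divide a ([initial_ideal_dvd]),
    and none does ([Omega_avoids]):
    - xi_{i,j} has leading monomial x_i x_j with 1 <= i <= j <= p - 1, whereas
      a has degree at most 1 in x_1, ..., x_{p-1};
    - theta and psi_j have leading monomials divisible by x_n, which does not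
      occur in a;
    - phi_i, for i >= 1, has leading monomial x_{r+i} x_p^q with
      r < r + i <= p, which contains either a variable x_{r+i} absent from a
      or a higher power of x_p.

    The hypothesis r' >= r enters twice.  Since z = u - (u - z), it gives
    r_z = p + r - r' >= r ([qt_rt_z]), so that the lower bound
    max(r_z - r + 1, 0) of I is at least 1.  With mu = 0 it also gives
    lambda = nu >= 2, so that x_0 divides the second term of every phi_i and
    the term x_{r+i} x_p^q is the leading one.

    All generators are differences of two monomials, and such a difference
    lies in P exactly when the two weights agree ([idealP_binomial]).  As a
    Groebner basis of P is contained in P, the leading monomial of each
    generator is therefore found by the reverse lexicographic tie-break
    alone, with no computation of weights. *)

(** * Monomials in an initial ideal *)

(** Each product in a representation of x^a has the form f x^b with x^b a
    leading monomial; one of them must contain x^a in its support. *)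
Lemma initial_ideal_dvd (K : fieldType) (n : nat) (m : nat -> nat)
    (A : {mpoly K[n.+1]} -> Prop) (a : 'X_{1..n.+1}) :
  initial_ideal m A 'X_[a] ->
  exists f b, [/\ A f, is_lead m f b & (b <= a)%MM].
Proof.
case=> s [sA Es].
have /hasP[c cs ca] : has (fun c => a \in msupp (c.1 * c.2)) s.
  apply: contraT => /hasPn noa; have /eqP := mcoeffX K a a.
  rewrite eqxx Es raddf_sum big_seq big1 /= ?(eq_sym 0) ?oner_eq0 // => c cs.
  exact/memN_msupp_eq0/noa.
have [f [b [Af lb Ec]]] := sA c cs; exists f, b; split=> //.
move: ca; rewrite Ec (perm_mem (msuppMX _ _)) => /mapP[b' _ ->].
exact: lem_addr.
Qed.

(** * Leading monomials of binomials *)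

Section Binomials.

Variables (K : fieldType) (n : nat) (m : nat -> nat).
Implicit Types a b c e : 'X_{1..n.+1}.

(** The tie-break of the monomial order, for monomials of equal weight. *)
Definition revlex_lt c b : Prop :=
  exists2 k : 'I_n.+1, (b k < c k)%N &
    forall j : 'I_n.+1, (j < k)%N -> b j = c j.

Lemma eta_monomial b : eta m ('X_[b] : {mpoly K[n.+1]}) = 'X^(wt m b).
Proof.
rewrite /eta mmapX /mmap1 /wt (big_morph _ (exprD 'X) (expr0 'X)).
by apply: eq_bigr => i _; rewrite -exprM mulnC.
Qed.

Lemma idealP_binomial b c :
  idealP m ('X_[b] - 'X_[c] : {mpoly K[n.+1]}) <-> wt m b = wt m c.
Proof.
have E : eta m ('X_[b] - 'X_[c] : {mpoly K[n.+1]}) = 'X^(wt m b) - 'X^(wt m c).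
  by rewrite -!eta_monomial /eta raddfB.
rewrite /idealP E.
split=> [/subr0_eq/(congr1 (fun p : {poly K} => size p))|->].
  by rewrite !size_polyXn => -[].
exact: subrr.
Qed.

Lemma grevlex_lt_wt c b : wt m c = wt m b -> revlex_lt c b -> grevlex_lt m c b.
Proof.
move=> Ew [k ltk eqk]; rewrite /grevlex_lt Ew eqxx ltnn /=.
apply/existsP; exists k; rewrite ltk; apply/forallP => j; apply/implyP => ltj.
exact/eqP/eqk.
Qed.

Lemma grevlex_lt_asym c b : grevlex_lt m c b -> ~~ grevlex_lt m b c.
Proof.
move=> lt_cb; apply/negP; move: lt_cb; rewrite /grevlex_lt.
case/orP=> [lt_w|/andP[/eqP-> /existsP[i /andP[lti /forallP eqi]]]].
  by case/orP=> [|/andP[/eqP]]; lia.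
rewrite ltnn eqxx => /existsP[j /andP[ltj /forallP eqj]].
have := eqi j; have := eqj i.
case: (ltngtP i j) => [ij /eqP|ji _ /eqP|/val_inj Eij]; try lia.
by move: lti ltj; rewrite Eij; lia.
Qed.

Lemma binomial_lead b c :
  grevlex_lt m c b -> is_lead m ('X_[b] - 'X_[c] : {mpoly K[n.+1]}) b.
Proof.
move=> lt_cb.
have ne_cb : c != b.
  by apply: contraTneq lt_cb => ->; apply/negP => h;
     move/negP: (grevlex_lt_asym h).
split.
  by rewrite mcoeff_msupp mcoeffB !mcoeffX eqxx (negPf ne_cb) subr0 oner_eq0.
move=> e /msuppB_le; rewrite mem_cat !msuppX !inE => /orP[->|/eqP->] //.
Qed.

Lemma lead_uniq (f : {mpoly K[n.+1]}) b c :
  is_lead m f b -> is_lead m f c -> b = c.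
Proof.
move=> [fb ltb] [fc ltc]; apply/eqP; apply: contraT => ne_bc.
have := grevlex_lt_asym (ltc b fb ne_bc).
by rewrite ltb // eq_sym.
Qed.

End Binomials.

(** * The monomials x_k x_p^e *)

Section VariablePowers.

Variables (K : fieldType) (n : nat).

(** The exponent vector of x_k x_p^e, where p = n - 1; it covers k = p. *)
Definition xmon (k e : nat) : 'X_{1..n.+1} :=
  (U_(inord k) + U_(inord n.-1) *+ e)%MM.

Lemma var_expE (k : nat) (i : 'I_n.+1) :
  (k <= n)%N -> (U_(inord k) : 'X_{1..n.+1})%MM i = (k == i).
Proof. by move=> le_kn; rewrite mnm1E -val_eqE /= inordK. Qed.

Lemma xpowE (k e : int) :
  0 <= e -> xpow K n k e = 'X_[xmon `|k|%N `|e|%N].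
Proof. by move=> e0; rewrite /xpow gt_eqF ?mpolyXD -?mpolyXn //; lia. Qed.

Lemma xmonE (k e : nat) (i : 'I_n.+1) :
  (k <= n)%N -> xmon k e i = ((k == i) + (n.-1 == i :> nat) * e)%N.
Proof. by move=> le_kn; rewrite mnmDE mulmnE !var_expE // leq_pred. Qed.

Lemma wtD (m : nat -> nat) (a b : 'X_{1..n.+1}) :
  wt m (a + b)%MM = (wt m a + wt m b)%N.
Proof.
by rewrite /wt -big_split; apply: eq_bigr => i _; rewrite mnmDE mulnDl.
Qed.

Lemma wt_var_exp (m : nat -> nat) (k e : nat) : (k <= n)%N ->
  wt m (U_(inord k : 'I_n.+1) *+ e)%MM = (e * m k)%N.
Proof.
move=> le_kn; rewrite /wt (bigD1 (inord k)) //= mulmnE var_expE // inordK //.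
rewrite eqxx mul1n big1 ?addn0 // => i; rewrite -val_eqE /= inordK // => ne_ik.
by rewrite mulmnE var_expE // eq_sym (negPf ne_ik).
Qed.

Lemma wt_xmon (m : nat -> nat) (k e : nat) : (k <= n)%N ->
  wt m (xmon k e) = (m k + e * m n.-1)%N.
Proof.
move=> le_kn; rewrite wtD wt_var_exp ?leq_pred //.
by rewrite -[U_(_)%MM in LHS]mulm1n wt_var_exp // mul1n.
Qed.

End VariablePowers.

(** * Quotients and remainders *)

Lemma qt_ge0 (n t : nat) : (2 <= n)%N -> (0 < t)%N -> 0 <= qt n t.
Proof. by move=> hn t_gt0; have [] := qt_rtP t hn; nia. Qed.

(** Subtracting u - z = q' p + r' from u = q p + r leaves the remainder
    r - r' <= 0, so one multiple of p is borrowed to return to [1, p]. *)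
Lemma qt_rt_z (n u z : nat) :
  (2 <= n)%N -> (z < u)%N -> (rt n u <= rt n (u - z))%N ->
  qt n z = qt n u - qt n (u - z) - 1
  /\ (rt n z)%:Z = n.-1%:Z + (rt n u)%:Z - (rt n (u - z))%:Z.
Proof.
move=> hn lt_zu hr.
have [] := qt_rtP z hn; have [] := qt_rtP u hn; have [] := qt_rtP (u - z) hn.
move: (qt n z) (rt n z) (qt n u) (rt n u) (qt n (u - z)) (rt n (u - z)) hr.
move=> qz rz q r q' r' le_r Ez' bz' Eu bu Ez bz.
have E1 : (q - q' - qz) * n.-1%:Z = rz%:Z + r'%:Z - r%:Z by lia.
have : q - q' - qz = 1; last by move=> D1; move: E1; rewrite D1; lia.
by move: (q - q' - qz) E1 => D E1; nia.
Qed.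

(** * Leading monomials of the Patil generators *)

Section Undivided.

Variables (K : fieldType) (n : nat).
Hypothesis hn : (2 <= n)%N.

(** When g is in P, the monomials b and c have equal weight, so b is the
    leading monomial of g and the predicate says that it does not divide a. *)
Definition lead_avoids (a : 'X_{1..n.+1}) (g : {mpoly K[n.+1]}) : Prop :=
  exists b c, [/\ g = 'X_[b] - 'X_[c], revlex_lt c b & ~~ (b <= a)%MM].

Lemma not_dvd (b a : 'X_{1..n.+1}) (k : nat) :
  (a (inord k) < b (inord k))%N -> ~~ (b <= a)%MM.
Proof. by move=> lt; apply/mnm_lepP => /(_ (inord k)); rewrite leqNgt lt. Qed.

Variables (r e : nat).
Hypothesis hr : (1 <= r <= n.-1)%N.

Lemma xi_avoids (i j : int) : 1 <= i -> i <= j -> j <= n.-1%:Z - 1 ->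
  lead_avoids (xmon n r e) (xi K n i j).
Proof.
move=> i1 le_ij jp.
(* In both cases the second term is x_k x_l with k < l and k < i. *)
pose k := if i + j <= n.-1%:Z then 0%N else `|(i + j - n.-1%:Z)%R|%N.
pose l := if i + j <= n.-1%:Z then `|(i + j)%R|%N else n.-1.
have [lt_ki le_kl ln] : [/\ (k < `|i|)%N, (k < l)%N & (l <= n)%N].
  by rewrite /k /l; case: ifP; split; lia.
exists (U_(inord `|i|%N) + U_(inord `|j|%N))%MM, (U_(inord k) + U_(inord l))%MM.
split.
- by rewrite /xi /k /l !mpolyXD; case: ifP.
- exists (inord k); first by rewrite !mnmDE !var_expE ?inordK; lia.
  by move=> s; rewrite !mnmDE !var_expE ?inordK; lia.
- (* If i = r = j then x_r^2 does not divide; otherwise x_i or x_j is absent. *)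
  have [ri|nri] := eqVneq r `|i|%N.
    by apply: (@not_dvd _ _ `|j|%N); rewrite mnmDE xmonE ?var_expE ?inordK; lia.
  by apply: (@not_dvd _ _ `|i|%N); rewrite mnmDE xmonE ?var_expE ?inordK; lia.
Qed.

Lemma xn_avoids (b : 'X_{1..n.+1}) :
  (0 < b (inord n))%N -> ~~ (b <= xmon n r e)%MM.
Proof.
by move=> b_gt0; apply: (@not_dvd _ _ n); rewrite xmonE ?inordK; lia.
Qed.

(** The second term of theta is x_{r_z} x_p^{q_z}; here the least variable in
    which the terms differ is x_{r_z}, and it makes x_n^upsilon leading. *)
Lemma theta_avoids (u ups z : nat) :
  (0 < ups)%N -> (0 < z < u)%N -> (rt n u <= rt n (u - z))%N ->
  lead_avoids (xmon n r e) (theta K n u ups z 0).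
Proof.
move=> ups_gt0 /andP[z_gt0 lt_zu] le_r.
have [Eq Er] := qt_rt_z hn lt_zu le_r; have [_ br] := qt_rtP z hn.
exists (U_(inord n) *+ ups)%MM, (xmon n (rt n z) `|qt n z|%N); split.
- rewrite /theta /= ltz_nat ltnNge le_r /= expr0 mul1r -Eq -Er.
  by rewrite xpowE ?qt_ge0 // -mpolyXn.
- exists (inord (rt n z)).
    by rewrite mulmnE xmonE ?var_expE ?inordK; lia.
  by move=> s; rewrite mulmnE xmonE ?var_expE ?inordK; lia.
- by apply: xn_avoids; rewrite mulmnE var_expE ?inordK; lia.
Qed.

Lemma phi_avoids (u w lam : nat) (i : int) :
  e = `|qt n u|%N -> r = rt n u -> (0 < u)%N -> (1 < lam)%N ->
  1 <= i -> i <= n.-1%:Z - r%:Z ->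
  lead_avoids (xmon n r e) (phi K n u w lam i).
Proof.
move=> Ee Er u_gt0 lam_gt1 i1 ip.
exists (xmon n `|(r%:Z + i)%R|%N e).
exists (U_(inord 0%N) *+ (lam - 1) + U_(inord `|i|%N) + U_(inord n) *+ w)%MM.
split.
- by rewrite /phi -Er xpowE ?qt_ge0 // -Ee !mpolyXD -!mpolyXn.
- by exists (inord 0) => [|s]; rewrite !mnmDE !mulmnE ?xmonE ?var_expE ?inordK; nia.
- by apply: (@not_dvd _ _ `|(r%:Z + i)%R|%N); rewrite !xmonE ?inordK; nia.
Qed.

Lemma psi_avoids (u ups w z nu : nat) (j : int) :
  (z < u)%N -> (w < ups)%N -> (1 < nu)%N ->
  0 <= j -> j <= n.-1%:Z - (rt n (u - z))%:Z ->
  lead_avoids (xmon n r e) (psi K n u ups w z nu j).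
Proof.
move=> lt_zu lt_w nu_gt1 j0 jp; have [_ br] := qt_rtP (u - z) hn.
exists (xmon n `|((rt n (u - z))%:Z + j)%R|%N `|qt n (u - z)|%N
        + U_(inord n) *+ (ups - w))%MM.
exists (U_(inord 0%N) *+ (nu - 1) + U_(inord `|j|%N))%MM.
split.
- by rewrite /psi xpowE ?qt_ge0 ?subn_gt0 // !mpolyXD -!mpolyXn.
- by exists (inord 0) => [|s]; rewrite !mnmDE !mulmnE ?xmonE ?var_expE ?inordK; nia.
- by apply: xn_avoids; rewrite mnmDE mulmnE xmonE ?var_expE ?inordK; nia.
Qed.

End Undivided.

Lemma Wset_neq0 (u ups w z : nat) : Wset u ups w z <> [::] -> (0 < z)%N.
Proof.
case: z => // hW; case: hW; rewrite /Wset.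
suff -> : zitv (u%:Z - 0%:Z) (u%:Z - 1) = [::] by [].
by rewrite /zitv; case: ifP => //; lia.
Qed.

(** The proof of i >= 1 for i in I is where r' <= p is used, through
    r_z = p + r - r' >= r. *)
Lemma Omega_avoids (K : fieldType) (n u ups w z lam nu : nat)
    (g : {mpoly K[n.+1]}) :
  (2 <= n)%N -> (z < u)%N -> (w < ups)%N -> (1 < lam)%N -> (1 < nu)%N ->
  (rt n u <= rt n (u - z))%N -> Wset u ups w z <> [::] ->
  g \in Omega K n u ups w z lam 0 nu ->
  lead_avoids (xmon n (rt n u) `|qt n u|%N) g.
Proof.
move=> hn lt_zu lt_w lam_gt1 nu_gt1 hr hW.
have z_gt0 := Wset_neq0 hW; have [_ br] := qt_rtP u hn.
have [_ br'] := qt_rtP (u - z) hn; have [_ Er] := qt_rt_z hn lt_zu hr.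
rewrite /Omega /Iset /Jset; rewrite (introF eqP hW).
rewrite mem_cat inE mem_cat.
case/or4P => [/allpairsPdep[i [j [+ + ->]]]|/eqP->|/mapP[i + ->]|/mapP[j + ->]].
- by rewrite !mem_zitv => /andP[i1 _] /andP[ij jp]; apply: xi_avoids.
- by apply: theta_avoids; lia.
- by rewrite mem_zitv => ib; apply: phi_avoids => //; lia.
- by rewrite mem_zitv => jb; apply: psi_avoids => //; lia.
Qed.

Theorem mainTheorem2 (K : fieldType) (n : nat) (m : nat -> nat)
    (u ups w z lam mu nu : nat)
    (hn : (2 <= n)%N)
    (hpos : forall i, (i <= n)%N -> (0 < m i)%N)
    (harith : arithmetic_upto n.-1 m)
    (hincr : forall i, (i < n.-1)%N -> (m i < m i.+1)%N)
    (hgcd : \big[gcdn/0%N]_(i < n.+1) m i = 1%N)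
    (hmin : minimally_generated n m)
    (hu : is_u n m u)
    (hups : is_upsilon n m ups)
    (hps : patil_singh n m u ups w z lam mu nu)
    (hr : (rt n u <= rt n (u - z))%N)
    (hmu : mu = 0%N)
    (hW : Wset u ups w z <> [::]) :
  ~ groebner_basis m (Omega K n u ups w z lam mu nu) (@idealP K n m).
Proof.
subst mu; case=> hP hin.
case: hps => [[lt_w lt_zu lam_ge1 nu_ge2] hgu _ _].
rewrite ltnNge hr /= addn0 => Enu.
have [_ br] := qt_rtP u hn; have q0 : 0 <= qt n u by apply: qt_ge0; lia.
(* The two monomials of phi_0. *)
pose a := xmon n (rt n u) `|qt n u|%N.
pose d := (U_(inord 0%N) *+ lam + U_(inord n) *+ w)%MM : 'X_{1..n.+1}.
have Ewt : wt m a = wt m d.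
  apply/eqP; rewrite -eqz_nat wt_xmon; last by lia.
  have -> : wt m d = (lam * m 0 + w * m n)%N.
    by rewrite /d wtD !wt_var_exp.
  by rewrite -hgu /gseq PoszD PoszM gez0_abs // addrC.
have lt_da : revlex_lt d a.
  exists (inord 0%N); first by rewrite /a /d mnmDE !mulmnE xmonE ?var_expE ?inordK; nia.
  by move=> s; rewrite inordK.
have [] := (hin 'X_[a]).2.
  exists [:: (1, 'X_[a])]; split; last by rewrite big_seq1 mul1r.
  move=> c; rewrite inE => /eqP-> /=; exists ('X_[a] - 'X_[d]), a; split=> //.
    exact/idealP_binomial.
  exact/binomial_lead/grevlex_lt_wt.
move=> s hs.
have [g [b [gO lb ba]]] := initial_ideal_dvd (ex_intro _ s hs).
have lam_ge2 : (2 <= lam)%N by rewrite -Enu.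
have [b' [c [Eg lt nba]]] := Omega_avoids hn lt_zu lt_w lam_ge2 nu_ge2 hr hW gO.
have /idealP_binomial Ebc : idealP m ('X_[b'] - 'X_[c] : {mpoly K[n.+1]}).
  by rewrite -Eg; apply: hP.
have lb' : is_lead m g b' by rewrite Eg; apply/binomial_lead/grevlex_lt_wt.
by move: nba; rewrite (lead_uniq lb' lb) ba.
Qed.
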